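(* Let $M$ be a von Neumann algebra, and let $\mathcal S(M)$ be the set of its von Neumann subalgebras (with the same unit as $M$), each $N\in\mathcal S(M)$ being identified with its closed unit ball $(N)_1\subseteq (M)_1$. The lower topologies on $\mathcal S(M)$ associated to the weak topology and to the strong-$*$ topology on the unit ball $(M)_1$ coincide.
   Context: $M$ is regarded as a von Neumann algebra of operators on a Hilbert space $\mathcal H$. A net $x_i\to x$ weakly if $\langle x_i\xi,\eta\rangle\to\langle x\xi,\eta\rangle$ for all $\xi,\eta\in\mathcal H$, and $x_i\to x$ strong-$*$ if $\|x_i\xi-x\xi\|\to 0$ and $\|x_i^*\xi-x^*\xi\|\to0$ for all $\xi\in\mathcal H$. For a topological space $X$, the lower topology on the set $\mathcal F(X)$ of closed subsets of $X$ is the topology generated by the sets $\{F\in\mathcal F(X): F\cap U\neq\emptyset\}$, $U\subseteq X$ open. For a topology $\tau$ on $(M)_1$ (weak or strong-$*$), the associated lower topology on $\mathcal S(M)$ is the one induced via $N\mapsto (N)_1$ by the lower topology of $\mathcal F((M)_1,\tau)$; i.e. it is generated by the sets $\{N\in\mathcal S(M): (N)_1\cap U\neq\emptyset\}$ for $U\subseteq (M)_1$ $\tau$-open. *)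

(* Defs.v *)
From HB Require Import structures.
From mathcomp Require Import all_boot all_order all_algebra complex.
From mathcomp Require Import all_classical all_reals all_analysis.

Set Implicit Arguments.
Unset Strict Implicit.
Unset Printing Implicit Defensive.

Import Order.TTheory GRing.Theory Num.Theory.
Import numFieldNormedType.Exports.

Local Open Scope classical_set_scope.
Local Open Scope ring_scope.

(* The norm is R[i]-valued, as for any normed module over a numFieldType, and
   the inner product is linear in its first argument. *)
HB.mixin Record isHilbert (R : realType) H
    & CompleteNormedModule R[i] H := {
  inner : {dot H for (@Num.conj R[i])} ;
  sqr_norm_inner : forall x : H, `|x| ^+ 2 = inner x x }.

#[short(type="hilbertType")]
HB.structure Definition Hilbert (R : realType) :=
  {H of isHilbert R H & CompleteNormedModule R[i] H}.

Section bounded_operators.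
Context {R : realType} (H : hilbertType R).

Definition bounded_linear : {pred H -> H} :=
  [pred f | `[< linear f /\ continuous f >]].

Fact bounded_linear_submod : GRing.submod_closed bounded_linear.
Proof.
split.
- apply/asboolP; split; last by move=> x; exact: cst_continuous.
  by move=> a u v; rewrite /GRing.zero /= scaler0 addr0.
- move=> a f g /asboolP[lf cf] /asboolP[lg cg]; apply/asboolP; split.
    move=> b u v; rewrite [LHS]/(a *: f _ + g _) [in RHS]/(a *: f + g).
    rewrite [X in _ = _ *: X + _]/(a *: f _ + g _).
    rewrite [X in _ = _ + X]/(a *: f _ + g _).
    by rewrite lf lg !scalerDr !scalerA (mulrC a b) addrACA.
  by move=> x; apply: cvgD; [apply: cvgZl_tmp; exact: cf | exact: cg].
Qed.

HB.instance Definition _ := GRing.isSubmodClosed.Build R[i] (H -> H)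
  bounded_linear bounded_linear_submod.

(* B(H) *)
Record bop := Bop { bop_fun :> H -> H ; bop_boundedP : bop_fun \in bounded_linear }.

HB.instance Definition _ := [isSub for bop_fun].
HB.instance Definition _ := [Choice of bop by <:].
HB.instance Definition _ := [SubChoice_isSubLmodule of bop by <:].

Fact id_bounded_linear : (id : H -> H) \in bounded_linear.
Proof. by apply/asboolP; split=> // x; exact: cvg_id. Qed.

Fact comp_bounded_linear (x y : bop) : (x \o y : H -> H) \in bounded_linear.
Proof.
have /asboolP[lx cx] := bop_boundedP x; have /asboolP[ly cy] := bop_boundedP y.
apply/asboolP; split; first by move=> a u v /=; rewrite ly lx.
by move=> t; apply: continuous_comp; [exact: cy | exact: cx].
Qed.

Definition bop_one : bop := Bop id_bounded_linear.
Definition bop_mul (x y : bop) : bop := Bop (comp_bounded_linear x y).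

Lemma bopP (x y : bop) : (forall v, x v = y v) -> x = y.
Proof. by move=> xy; apply/val_inj/funext. Qed.

Lemma bopD (x y : bop) v : (x + y) v = x v + y v.
Proof. by []. Qed.

Lemma bopZ a (x : bop) v : (a *: x) v = a *: x v.
Proof. by []. Qed.

Lemma bop_linear (x : bop) : linear x.
Proof. by have /asboolP[] := bop_boundedP x. Qed.

Lemma bop_continuous (x : bop) : continuous x.
Proof. by have /asboolP[] := bop_boundedP x. Qed.

Fact bop_mulA : associative bop_mul.
Proof. by move=> x y z; apply: bopP. Qed.
Fact bop_mul1 : left_id bop_one bop_mul.
Proof. by move=> x; apply: bopP. Qed.
Fact bop_mulr1 : right_id bop_one bop_mul.
Proof. by move=> x; apply: bopP. Qed.
Fact bop_mulDl : left_distributive bop_mul +%R.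
Proof. by move=> x y z; apply: bopP. Qed.
Fact bop_mulDr : right_distributive bop_mul +%R.
Proof.
move=> x y z; apply: bopP => v; have := bop_linear x 1 (y v) (z v).
by rewrite !scale1r; exact.
Qed.

(* a possibly zero ring, as H may be the zero space *)
HB.instance Definition _ := GRing.Zmodule_isPzRing.Build bop
  bop_mulA bop_mul1 bop_mulr1 bop_mulDl bop_mulDr.

End bounded_operators.

Section operator_topologies.
Context {R : realType} {H : hilbertType R}.

(* The y below exists and is unique (Riesz representation theorem). *)
Definition adjoint (x : bop H) : bop H :=
  xget 0 [set y : bop H | forall u v : H, inner (x u) v = inner u (y v)].

Definition op_norm (x : bop H) : R :=
  sup [set complex.Re `|x u| | u in [set u : H | `|u| <= 1]].

Definition unit_ball (N : set (bop H)) : set (bop H) :=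
  [set x | N x /\ op_norm x <= 1].

Definition matrix_coefficients (x : bop H) : {ptws (H * H)%type -> R[i]^o} :=
  fun uv => inner (x uv.1) uv.2.

Definition values_and_adjoint_values (x : bop H) :
    {ptws H -> H} * {ptws H -> H} := (x : H -> H, adjoint x : H -> H).

(* The coarsest topology for which x |-> inner (x u) v is continuous for all
   u and v. *)
Definition weak_bop := initial_topology matrix_coefficients.
HB.instance Definition _ := Topological.on weak_bop.

(* The coarsest topology for which x |-> x u and x |-> adjoint x u are
   norm-continuous for all u. *)
Definition strong_star_bop := initial_topology values_and_adjoint_values.
HB.instance Definition _ := Topological.on strong_star_bop.

Record von_neumann_algebra (M : set (bop H)) : Prop := {
  vna_one : M 1 ;
  vna_add : forall x y, M x -> M y -> M (x + y) ;
  vna_scale : forall (a : R[i]) x, M x -> M (a *: x) ;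
  vna_mul : forall x y, M x -> M y -> M (x * y) ;
  vna_adjoint : forall x, M x -> M (adjoint x) ;
  vna_weakly_closed : @closed weak_bop M }.

(* The set S(M); since the unit of B(H) belongs to N, it is also that of N. *)
Definition vn_subalgebras (M : set (bop H)) : set (set (bop H)) :=
  [set N | von_neumann_algebra N /\ N `<=` M].

End operator_topologies.
Arguments weak_bop {R} H.
Arguments strong_star_bop {R} H.

(* The topology on S induced by the lower topology on the subsets of X through
   F : S -> set X: it is generated by the sets of all s such that F s meets U,
   for U open in X. *)
Definition lower_topology {S X : Type} (F : S -> set X) : Type := S.

Section lower_topology.
Context {S : choiceType} {X : topologicalType} (F : S -> set X).

HB.instance Definition _ := Choice.on (lower_topology F).
HB.instance Definition _ := @isSubBaseTopological.Build (lower_topology F)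
  (set X) [set U | open U] (fun U => [set s | F s `&` U !=set0]).

End lower_topology.

Section lower_topologies_of_subalgebras.
Context {R : realType} {H : hilbertType R} (M : set (bop H)).

(* (N)_1 as a subset of the space (M)_1, which carries the subspace topology of
   the weak, resp. strong-star, topology of B(H) *)
Definition weak_ball_of (N : vn_subalgebras M) :
    set (unit_ball M : set (weak_bop H)) :=
  [set x | unit_ball (set_val N) (set_val x)].

Definition strong_star_ball_of (N : vn_subalgebras M) :
    set (unit_ball M : set (strong_star_bop H)) :=
  [set x | unit_ball (set_val N) (set_val x)].

Definition weak_lower := lower_topology weak_ball_of.
HB.instance Definition _ := Topological.on weak_lower.

Definition strong_star_lower := lower_topology strong_star_ball_of.
HB.instance Definition _ := Topological.on strong_star_lower.

End lower_topologies_of_subalgebras.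

(* Main.v *)
Require Import Defs.
From mathcomp Require Import all_boot all_order all_algebra complex.
From mathcomp Require Import all_classical all_reals all_analysis.
From mathcomp Require Import sesquilinear finmap ring lra.

Local Open Scope classical_set_scope.
Local Open Scope ring_scope.

(** Why the two lower topologies agree. One inclusion is formal: weakly open
    sets are strong-star open. For the other, fix a von Neumann algebra A, a
    contraction x of A and a strong-star neighbourhood V of x. The point is
    that, for every B close to A in the weak lower topology, the unit ball of B
    meets V; call x approximable when this holds for all V
    ([strong_star_lower_nbhs]).

    Unitaries are approximable, because at a unitary u the two topologies have
    the same traces on the unit ball: if |y v| <= |v| = |u v| then
    |u v - y v|^2 <= 2 (<u v, u v> - Re <y v, u v>), and the same estimate
    holds for the adjoints since u^* is isometric as well
    ([unitary_weak_strong_star]). Approximability passes to midpoints, as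
    finite intersections of neighbourhoods of A are neighbourhoods and unit
    balls are convex, and to strong-star limits of sequences. Hence everything
    reduces to a form of the Russo-Dye theorem: every contraction of A is
    obtained from unitaries of A by midpoints and limits ([russo_dye]).

    This is proved along Gardner's argument. If |x| < 1, then y = (1 + x) / 2
    is invertible with |y| < 1; its polar decomposition y = v s, where
    s^2 = y^* y, combined with s = ((s + i t) + (s - i t)) / 2, where
    t^2 = 1 - s^2, exhibits y as the midpoint of the unitaries v (s + i t) and
    v (s - i t) ([half_one_add_unitaries]). So the midpoint of x with a mean of
    unitaries is again a mean of unitaries, and iterating z |-> (z + x) / 2
    converges to x. The only functional calculus needed is square roots of
    1 - c with |c| < 1 and inverses of 1 - z with |z| < 1. Both are fixed
    points of contractions of B(H), and the iteration stays in A and in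
    whatever commutant is relevant ([contraction_fixpoint]).

    The basic theory of adjoints rests on the Riesz representation theorem,
    obtained by minimizing |v|^2 - 2 f v ([riesz_real]). Norms and inner
    products are used through their real parts, which determine the inner
    product because Im <u, v> = - Re <i u, v>. *)

Set Implicit Arguments.
Unset Strict Implicit.
Unset Printing Implicit Defensive.
Import Order.TTheory GRing.Theory Num.Theory.
Import numFieldNormedType.Exports.

(** * Geometry of the Hilbert space *)

Section geometry.
Context {R : realType} {H : hilbertType R}.
Implicit Types u v w : H.
Local Notation "x %:C" := (real_complex R x) : ring_scope.

(** The real-valued norm and real inner product underlying the complex ones:
    estimates are then carried out in the ordered field R. *)
Definition rnorm v : R := complex.Re `|v|.
Definition rinner u v : R := complex.Re (inner u v).

Lemma rnormE v : `|v| = (rnorm v)%:C.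
Proof. by rewrite /rnorm RRe_real // ger0_real. Qed.

Lemma rnorm_ge0 v : 0 <= rnorm v.
Proof. by rewrite -ler0c -rnormE. Qed.

Lemma rnorm_triangle u v : rnorm (u + v) <= rnorm u + rnorm v.
Proof. by rewrite -lecR rmorphD /= -!rnormE ler_normD. Qed.

Lemma rnormN v : rnorm (- v) = rnorm v.
Proof. by rewrite /rnorm normrN. Qed.

Lemma rnorm0 : rnorm 0 = 0.
Proof. by rewrite /rnorm normr0. Qed.

Lemma rnorm0_eq0 v : rnorm v = 0 -> v = 0.
Proof. by move=> v0; apply/eqP; rewrite -normr_eq0 rnormE v0. Qed.

Lemma rnormZ (a : R) v : rnorm (a%:C *: v) = `|a| * rnorm v.
Proof.
apply: complexI; rewrite -rnormE normrZ rnormE rmorphM /=; congr (_ * _).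
by rewrite normc_def /= expr0n addr0 sqrtr_sqr.
Qed.

Lemma sqr_rnorm v : rnorm v ^+ 2 = rinner v v.
Proof.
apply: complexI; rewrite rmorphXn /= -rnormE sqr_norm_inner.
by rewrite RRe_real // ger0_real // dnorm_ge0.
Qed.

Lemma innerC u v : inner u v = Num.conj (inner v u).
Proof. by rewrite (hermC inner) expr0 mul1r. Qed.

Lemma conjE (z : R[i]) : Num.conj z = conjc z.
Proof. by []. Qed.

Lemma rinnerC u v : rinner u v = rinner v u.
Proof. by rewrite /rinner innerC; case: (inner v u). Qed.

Lemma rinnerDl u v w : rinner (u + v) w = rinner u w + rinner v w.
Proof. by rewrite /rinner linearDl raddfD. Qed.
Lemma rinnerNl u w : rinner (- u) w = - rinner u w.
Proof. by rewrite /rinner linearNl raddfN. Qed.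
Lemma rinnerZl (a : R) u w : rinner (a%:C *: u) w = a * rinner u w.
Proof.
by rewrite /rinner linearZl_LR /=; case: (inner u w) => x y /=; rewrite mul0r subr0.
Qed.
Lemma rinnerDr u v w : rinner w (u + v) = rinner w u + rinner w v.
Proof. by rewrite rinnerC rinnerDl !(rinnerC w). Qed.
Lemma rinnerNr u w : rinner w (- u) = - rinner w u.
Proof. by rewrite rinnerC rinnerNl (rinnerC w). Qed.
Lemma rinnerZr (a : R) u w : rinner w (a%:C *: u) = a * rinner w u.
Proof. by rewrite rinnerC rinnerZl (rinnerC w). Qed.

Definition rinnerE := (rinnerDl, rinnerDr, rinnerNl, rinnerNr, rinnerZl, rinnerZr).

Lemma sqr_rnormD u v :
  rnorm (u + v) ^+ 2 = rnorm u ^+ 2 + 2 * rinner u v + rnorm v ^+ 2.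
Proof. by rewrite !sqr_rnorm !rinnerE (rinnerC v u); ring. Qed.

Lemma sqr_rnormB u v :
  rnorm (u - v) ^+ 2 = rnorm u ^+ 2 - 2 * rinner u v + rnorm v ^+ 2.
Proof. by rewrite !sqr_rnorm !rinnerE (rinnerC v u); ring. Qed.

Lemma inner_rinner u v : inner u v = Complex (rinner u v) (- rinner ('i%C *: u) v).
Proof.
by rewrite /rinner linearZl_LR /=; case: (inner u v) => x y /=; congr Complex; ring.
Qed.

Lemma le_rinner u v : `|rinner u v| <= rnorm u * rnorm v.
Proof.
have [v0|v0] := eqVneq (rnorm v) 0.
  rewrite v0 mulr0 (rnorm0_eq0 v0) -(subrr v) rinnerDr rinnerNr subrr normr0 //.
rewrite -(ler_pXn2r (n:=2)) ?nnegrE ?mulr_ge0 ?rnorm_ge0 //.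
rewrite real_normK ?num_real // exprMn.
have v2 : 0 < rnorm v ^+ 2 by rewrite exprn_gt0 // lt_def v0 rnorm_ge0.
have := sqr_ge0 (rnorm (u - (rinner u v / rnorm v ^+ 2)%:C *: v)).
rewrite sqr_rnormB rinnerZr rnormZ exprMn real_normK ?num_real //.
rewrite (_ : _ + _ = (rnorm u ^+ 2 * rnorm v ^+ 2 - rinner u v ^+ 2) / rnorm v ^+ 2).
  by rewrite pmulr_lge0 ?invr_gt0 // subr_ge0.
by field.
Qed.

(** The complex Cauchy-Schwarz inequality follows from the real one after
    rotating u by the phase c that makes the inner product nonnegative. *)
Lemma normc_inner u v : `|inner u v| <= (rnorm u * rnorm v)%:C.
Proof.
have [z0|z0] := eqVneq (inner u v) 0.
  by rewrite z0 normr0 ler0c mulr_ge0 ?rnorm_ge0.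
set z := inner u v in z0 *.
pose c := z^* / `|z|.
have cz : c * z = `|z|.
  by rewrite mulrAC (mulrC _ z) -normCK expr2 mulfK // normr_eq0.
have c1 : `|c| = 1.
  by rewrite normrM normfV normr_id norm_conjC divff // normr_eq0.
have -> : rnorm u = rnorm (c *: u) by rewrite /rnorm normrZ c1 mul1r.
rewrite -cz -linearZl_LR /= inner_rinner.
have := le_rinner (c *: u) v; rewrite ler_norml => /andP[_ h].
have := cz; rewrite -linearZl_LR /= inner_rinner => h2.
by rewrite lecE /= h andbT; have := ger0_Im (normr_ge0 z); rewrite -h2 /= => ->.
Qed.

Lemma rinner_injr v w : (forall u, rinner u v = rinner u w) -> v = w.
Proof.
move=> vw; apply/eqP; rewrite -subr_eq0; apply/eqP/rnorm0_eq0/eqP.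
by rewrite -sqrf_eq0 sqr_rnorm rinnerDr rinnerNr vw subrr.
Qed.

Lemma cvg_rnormP T (F : set_system T) (FF : Filter F) (f : T -> H) l :
  f @ F --> l <-> forall e : R, 0 < e -> \forall t \near F, rnorm (l - f t) < e.
Proof.
split=> [/cvgrPdist_lt fl e e0|fl].
  have := fl e%:C; rewrite ltcR => /(_ e0); apply: filterS => t.
  by rewrite rnormE ltcR.
apply/cvgrPdist_lt => -[a b]; rewrite ltcE /= => /andP[/eqP -> a0].
by apply: filterS (fl _ a0) => t; rewrite rnormE ltcR.
Qed.

Lemma rnorm_complete (z : nat -> H) :
  (forall e : R, 0 < e -> exists N, forall m n, (N <= m)%N -> (N <= n)%N ->
    rnorm (z m - z n) < e) -> exists l : H, z @ \oo --> l.
Proof.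
move=> zC; apply/cvg_ex.
apply/cauchy_cvgP/cauchy_exP => -[a b]; rewrite ltcE /= => /andP[/eqP -> a0].
have [N zN] := zC a a0; exists (z N); exists N => // n /= Nn.
by rewrite -ball_normE /ball_ /= rnormE ltcR; exact: zN.
Qed.

(** Riesz representation of a bounded real-linear functional. The functional
    J v = |v|^2 - 2 f v is bounded below, the parallelogram law makes its
    minimizing sequences Cauchy, and stationarity of J at the limit z along
    every line says that f v = Re <v, z>. Minimizing J rather than the norm
    on the hyperplane f = 1 covers f = 0 uniformly. *)
Lemma riesz_real (f : H -> R) (K : R) :
  (forall u v, f (u + v) = f u + f v) -> (forall (a : R) u, f (a%:C *: u) = a * f u) ->
  (forall u, `|f u| <= K * rnorm u) -> exists z, forall v, f v = rinner v z.
Proof.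
move=> fD fZ fK.
pose J v := rnorm v ^+ 2 - 2 * f v.
have Jlb v : - K ^+ 2 <= J v.
  have := fK v; rewrite ler_norml => /andP[_ h].
  have : 0 <= (rnorm v - K) ^+ 2 by apply: sqr_ge0.
  rewrite /J; nra.
pose S := [set J v | v in setT].
have infS : has_inf S.
  by split; [exists (J 0), 0 | exists (- K ^+ 2) => _ [v _ <-]].
pose m := inf S.
have mJ v : m <= J v by apply: ge_inf; [case: infS | exists v].
have /choice [z zm] n : exists v, J v < m + n.+1%:R^-1.
  have : (0 : R) < n.+1%:R^-1 by rewrite invr_gt0 ltr0n.
  by move=> /inf_adherent /(_ infS) [_ [v _ <-]] h; exists v.
have fN u : f (- u) = - f u.
  by have := fZ (-1) u; rewrite rmorphN /= scaleN1r mulN1r.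
have par u v : rnorm (u - v) ^+ 2 = 2 * J u + 2 * J v - 4 * J ((2^-1)%:C *: (u + v)).
  rewrite /J !fZ !fD !sqr_rnorm !rinnerE (rinnerC v u); by field.
have [l zl] : exists l : H, z @ \oo --> l.
  apply: rnorm_complete => e e0.
  have e2 : 0 < e ^+ 2 / 4 by rewrite divr_gt0 ?exprn_gt0.
  have [N _ hN] := near_infty_natSinv_lt (PosNum e2).
  exists N => i j Ni Nj.
  rewrite -(ltr_pXn2r (n:=2)) ?nnegrE ?rnorm_ge0 ?ltW // par.
  have := zm i; have := zm j; have := mJ ((2^-1)%:C *: (z i + z j)).
  have := hN i Ni; have := hN j Nj; rewrite /=.
  move: (j.+1%:R^-1) (i.+1%:R^-1) (J _) (J (z j)) (J (z i)) (e ^+ 2) => *; lra.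
exists l => v.
(* J (l + t v) - J l is this quadratic polynomial in t. Its sign is obtained
   from the z n, at the cost of the error n.+1^-1. *)
have key (t : R) : 0 <= t ^+ 2 * rnorm v ^+ 2 + 2 * t * (rinner v l - f v).
  rewrite leNgt; apply/negP => h0.
  set q := t ^+ 2 * _ + _ in h0.
  have c0 : 0 < `|t| * rnorm v + 1 by rewrite ltr_wpDl ?mulr_ge0 ?rnorm_ge0.
  have e0 : 0 < - q / (4 * (`|t| * rnorm v + 1)).
    by rewrite divr_gt0 ?mulr_gt0 // oppr_gt0.
  have /cvg_rnormP /(_ _ e0) [N1 _ h1] := zl.
  have q0 : 0 < - q / 4 by rewrite divr_gt0 // oppr_gt0.
  have [N2 _ h2] := near_infty_natSinv_lt (PosNum q0).
  pose n := maxn N1 N2.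
  have /= := h1 n (leq_maxl _ _); have /= := h2 n (leq_maxr _ _).
  move=> h3; rewrite ltr_pdivlMr ?mulr_gt0 // => h4.
  have := mJ (z n + t%:C *: v); have := zm n.
  rewrite /J fD fZ sqr_rnormD rinnerZr rnormZ exprMn real_normK ?num_real //.
  move=> h5 h6.
  have := le_rinner v (l - z n); rewrite rinnerDr rinnerNr => h7.
  have h8 : `|t * (rinner v l - rinner v (z n))| <= `|t| * rnorm v * rnorm (l - z n).
    by rewrite normrM -mulrA ler_wpM2l.
  move: h8; rewrite ler_norml => /andP[h8 h9].
  have h10 := rnorm_ge0 (l - z n).
  rewrite (rinnerC (z n)) in h6.
  have h11 : 0 <= `|t| * rnorm v * rnorm (l - z n) <= - q / 4.
    rewrite !mulr_ge0 ?rnorm_ge0 //= ler_pdivlMr // ltW // (le_lt_trans _ h4) //.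
    nra.
  move: h11 => /andP[_ h11].
  have qE : q = t ^+ 2 * rnorm v ^+ 2 + 2 * (t * (rinner v l - rinner v (z n)))
      + 2 * (t * rinner v (z n)) - 2 * (t * f v) by rewrite /q; ring.
  move: (t * (_ - _)) (t * rinner _ _) (t * f v) (_ * _ * _) (n.+1%:R^-1) (t ^+ 2 * _)
    qE h11 h6 h5 h8 h9 h3 h0 => a b c d e g *; lra.
apply/eqP; rewrite eq_sym -subr_eq0; apply/eqP.
set d := _ - _ in key *.
have [v0|v0] := eqVneq (rnorm v) 0.
  have h1 := key 1; have h2 := key (-1).
  by rewrite v0 in h1 h2; lra.
have v2 : 0 < rnorm v ^+ 2 by rewrite exprn_gt0 // lt_def v0 rnorm_ge0.
(* the minimum of the quadratic polynomial *)
have := key (- d / rnorm v ^+ 2).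
rewrite (_ : _ + _ = - (d ^+ 2 / rnorm v ^+ 2)); last by field.
rewrite oppr_ge0 => h; apply/eqP; rewrite -sqrf_eq0 eq_le sqr_ge0 andbT.
by rewrite pmulr_lle0 ?invr_gt0 in h.
Qed.

End geometry.

(** * Adjoints and bounds of operators *)

Section operators.
Context {R : realType} {H : hilbertType R}.
Implicit Types (u v w : H) (x y z : bop H).
Local Notation "x %:C" := (real_complex R x) : ring_scope.

Lemma bop0 (x : bop H) : x 0 = 0.
Proof. by have := bop_linear x (-1) 0 0; rewrite scaler0 addr0 scaleN1r addNr. Qed.
Lemma bop_addr x u v : x (u + v) = x u + x v.
Proof. by have := bop_linear x 1 u v; rewrite !scale1r. Qed.
Lemma bop_scaler x a v : x (a *: v) = a *: x v.
Proof. by have := bop_linear x a v 0; rewrite !addr0 bop0 addr0. Qed.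
Lemma bop_mulE x y v : (x * y) v = x (y v). Proof. by []. Qed.
Lemma bop_subE x y v : (x - y) v = x v - y v. Proof. by []. Qed.

(** Explicit bounds are used instead of the operator norm, which is a supremum
    and would have to be shown finite each time; [op_norm_le1] connects them. *)
Definition bounded_by (k : R) x := forall v, rnorm (x v) <= k * rnorm v.

Lemma bop_bounded x : exists2 k, 0 <= k & bounded_by k x.
Proof.
have /cvg_rnormP /(_ 1 ltr01) := @bop_continuous _ _ x 0.
rewrite -nbhs_ballE => -[[d b] /=]; rewrite ltcE /= => /andP[/eqP -> d0].
rewrite bop0 -ball_normE => h.
exists (2 / d) => [|v]; first by rewrite divr_ge0 // ltW.
have [v0|v0] := eqVneq (rnorm v) 0.
  by rewrite (rnorm0_eq0 v0) bop0 rnorm0 mulr0.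
have v1 : 0 < rnorm v by rewrite lt_def v0 rnorm_ge0.
have c0 : 0 < d / (2 * rnorm v) by rewrite divr_gt0 // mulr_gt0.
have := h ((d / (2 * rnorm v))%:C *: v).
rewrite /ball_ /= !sub0r rnormE ltcR !rnormN bop_scaler !rnormZ !gtr0_norm //.
have -> : d / (2 * rnorm v) * rnorm v = d / 2 by field.
have hd : d / 2 < d by lra.
move=> /(_ hd) /ltW; rewrite mulrC -ler_pdivlMr // div1r invf_div.
by rewrite -mulrA (mulrC (rnorm v)) mulrA.
Qed.

Lemma bounded_linear_of_bound (f : H -> H) (k : R) : linear f ->
  (forall v, rnorm (f v) <= k * rnorm v) -> f \in @bounded_linear R H.
Proof.
move=> fl fk; apply/asboolP; split => // v; apply/cvg_rnormP => e e0.
have fB u : f v - f u = f (v - u).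
  by have := fl (-1) u v; rewrite !scaleN1r addrC => <-; rewrite addrC.
have k0 : 0 < `|k| + 1 by rewrite ltr_wpDl.
have : nbhs v [set u | rnorm (v - u) < e / (`|k| + 1)].
  by have /cvg_rnormP := @cvg_id _ (nbhs v); apply; rewrite divr_gt0.
apply: filterS => u /=; rewrite ltr_pdivlMr // fB => h.
have h1 := fk (v - u); have h2 := rnorm_ge0 (v - u); have h3 := ler_norm k; nra.
Qed.

Lemma op_norm_le1 x : op_norm x <= 1 <-> bounded_by 1 x.
Proof.
have [k k0 xk] := bop_bounded x.
set S := [set complex.Re `|x u| | u in [set u : H | `|u| <= 1]].
have supS : has_sup S.
  split; first by exists (complex.Re `|x 0|), 0 => //=; rewrite normr0 ler01.
  exists k => _ [u /= u1 <-]; apply: le_trans (xk u) _.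
  by rewrite ler_piMr // -lecR -rnormE.
split=> [x1 v|x1].
  have [v0|v0] := eqVneq (rnorm v) 0.
    by rewrite (rnorm0_eq0 v0) bop0 rnorm0 mulr0.
  have v1 : 0 < rnorm v by rewrite lt_def v0 rnorm_ge0.
  have vi0 : 0 < (rnorm v)^-1 by rewrite invr_gt0.
  have : rnorm (x ((rnorm v)^-1%:C *: v)) <= 1.
    apply: le_trans x1; apply: ub_le_sup; first by case: supS.
    exists ((rnorm v)^-1%:C *: v) => //=.
    by rewrite rnormE rnormZ gtr0_norm // mulVf.
  by rewrite bop_scaler rnormZ gtr0_norm // mulrC ler_pdivrMr.
rewrite /op_norm -/S; apply: ge_sup; first by case: supS.
move=> _ [u /= u1 <-]; apply: le_trans (x1 u) _.
by rewrite mul1r -lecR -rnormE.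
Qed.

Lemma bounded_byM k l x y : 0 <= k -> bounded_by k x -> bounded_by l y ->
  bounded_by (k * l) (x * y).
Proof.
by move=> k0 xk yl v; rewrite -mulrA; apply: le_trans (xk _) _; rewrite ler_wpM2l.
Qed.

Lemma bounded_byD k l x y : bounded_by k x -> bounded_by l y ->
  bounded_by (k + l) (x + y).
Proof.
move=> xk yl v; rewrite bopD mulrDl; apply: le_trans (rnorm_triangle _ _) _.
exact: lerD.
Qed.

Lemma bounded_byZ k (a : R) x : bounded_by k x -> bounded_by (`|a| * k) (a%:C *: x).
Proof. by move=> xk v; rewrite bopZ rnormZ -mulrA ler_wpM2l. Qed.

Lemma bounded_byN k x : bounded_by k x -> bounded_by k (- x).
Proof. by move=> xk v; rewrite -[(- x) v]/(- x v) rnormN. Qed.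

Lemma bounded_by1 : bounded_by 1 (1 : bop H).
Proof. by move=> v; rewrite mul1r. Qed.

Lemma bounded_byW k l x : k <= l -> bounded_by k x -> bounded_by l x.
Proof. by move=> kl xk v; apply: le_trans (xk v) _; rewrite ler_wpM2r ?rnorm_ge0. Qed.

Lemma conj_i : ('i%C : R[i])^* = - 'i%C.
Proof. by apply/eqP; rewrite eq_complex /= oppr0 !eqxx. Qed.

Lemma rinner_conj a u v : rinner (a *: u) v = rinner u (a^* *: v).
Proof. by rewrite /rinner linearZl_LR linearZr_LR /= conjCK. Qed.

Lemma adjoint_exists x : exists y : bop H, forall u v, rinner (x u) v = rinner u (y v).
Proof.
have [k k0 xk] := bop_bounded x.
have /choice [f fE] v : exists w, forall u, rinner (x u) v = rinner u w.
  apply: (@riesz_real _ _ (fun u => rinner (x u) v) (k * rnorm v)).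
  - by move=> u w; rewrite bop_addr rinnerDl.
  - by move=> a u; rewrite bop_scaler rinnerZl.
  - move=> u; apply: le_trans (le_rinner _ _) _.
    by rewrite mulrAC ler_wpM2r ?rnorm_ge0.
have fl : linear f.
  move=> a v w; apply: rinner_injr => u.
  rewrite -fE !rinnerDr -fE -[a]conjCK -!rinner_conj -bop_scaler fE //.
have fk v : rnorm (f v) <= k * rnorm v.
  have [v0|v0] := eqVneq (rnorm (f v)) 0.
    by rewrite v0 mulr_ge0 ?rnorm_ge0.
  have v1 : 0 < rnorm (f v) by rewrite lt_def v0 rnorm_ge0.
  rewrite -(ler_pM2r v1) -expr2 sqr_rnorm -fE.
  have := le_rinner (x (f v)) v; rewrite ler_norml => /andP[_ h].
  apply: le_trans h _; rewrite mulrAC ler_wpM2r ?rnorm_ge0 //.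
by exists (Bop (bounded_linear_of_bound fl fk)) => u v; rewrite /= -fE.
Qed.

Lemma inner_rinner_eq (f g : H -> H) :
  (forall u v, rinner (f u) v = rinner u (g v)) ->
  (forall a u, f (a *: u) = a *: f u) ->
  forall u v, inner (f u) v = inner u (g v).
Proof. by move=> fg fZ u v; rewrite !inner_rinner -fZ !fg. Qed.

(** The complex identity, which characterizes the adjoint, is recovered from
    the real one by [inner_rinner_eq]. *)
Lemma adjointP x u v : rinner (x u) v = rinner u (adjoint x v).
Proof.
rewrite /rinner; congr complex.Re; rewrite /adjoint.
case: xgetP => [y _ ->//|]; have [y xy] := adjoint_exists x.
by move=> /(_ y); case=> ? ?; apply: inner_rinner_eq => //; exact: bop_scaler.
Qed.

Lemma adjointPl x u v : rinner (adjoint x u) v = rinner u (x v).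
Proof. by rewrite rinnerC -adjointP rinnerC. Qed.

Lemma adjoint_unique x y :
  (forall u v, rinner (x u) v = rinner u (y v)) -> adjoint x = y.
Proof. by move=> xy; apply: bopP => v; apply: rinner_injr => u; rewrite -adjointP. Qed.

Lemma adjointK : involutive (@adjoint R H).
Proof. by move=> x; apply: adjoint_unique => u v; rewrite adjointPl. Qed.

Lemma adjointD x y : adjoint (x + y) = adjoint x + adjoint y.
Proof.
by apply: adjoint_unique => u v; rewrite !bopD rinnerDl rinnerDr !adjointP.
Qed.

Lemma adjointZ a x : adjoint (a *: x) = a^* *: adjoint x.
Proof. by apply: adjoint_unique => u v; rewrite !bopZ rinner_conj adjointP -bop_scaler. Qed.

Lemma adjointN x : adjoint (- x) = - adjoint x.
Proof. by rewrite -[in LHS]scaleN1r adjointZ rmorphN rmorph1 scaleN1r. Qed.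

Lemma adjointM x y : adjoint (x * y) = adjoint y * adjoint x.
Proof. by apply: adjoint_unique => u v; rewrite !bop_mulE !adjointP. Qed.

Lemma adjoint1 : adjoint (1 : bop H) = 1.
Proof. exact: adjoint_unique. Qed.

Lemma adjointZr (a : R) x : adjoint (a%:C *: x) = a%:C *: adjoint x.
Proof. by rewrite adjointZ; congr (_ *: _); rewrite conjE conjc_real. Qed.

Lemma bounded_by_adjoint k x : 0 <= k -> bounded_by k x -> bounded_by k (adjoint x).
Proof.
move=> k0 xk v; have [v0|v0] := eqVneq (rnorm (adjoint x v)) 0.
  by rewrite v0 mulr_ge0 ?rnorm_ge0.
have v1 : 0 < rnorm (adjoint x v) by rewrite lt_def v0 rnorm_ge0.
rewrite -(ler_pM2r v1) -expr2 sqr_rnorm -adjointP.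
have := le_rinner (x (adjoint x v)) v; rewrite ler_norml => /andP[_ h].
by apply: le_trans h _; rewrite mulrAC ler_wpM2r ?rnorm_ge0.
Qed.

Lemma bop_scalerAl a x y : a *: (x * y) = (a *: x) * y.
Proof. exact: bopP. Qed.
Lemma bop_scalerAr a x y : a *: (x * y) = x * (a *: y).
Proof. by apply: bopP => v; rewrite !bop_mulE !bopZ bop_mulE bop_scaler. Qed.

End operators.

(** * Weak and strong-star convergence *)

Section topology.
Lemma cvg_initialP (S : choiceType) (T : topologicalType) (f : S -> T)
    (F : set_system S) (FF : Filter F) (s : S) :
  F --> (s : initial_topology f) <-> f @ F --> f s.
Proof.
split=> [Fs|fFs].
  move=> A /(@initial_continuous _ _ f s); exact: Fs.
move=> A; rewrite nbhsE => -[_ [[B oB <-] Bfs] BA].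
have : (f @ F) B by apply: fFs; exact: open_nbhs_nbhs.
move=> FB; exact: (@filterS _ F FF _ _ BA FB).
Qed.

Lemma cvg_ptwsP (I : Type) (T : topologicalType)
    (F : set_system (I -> T)) (FF : Filter F) (f : I -> T) :
  F --> (f : {ptws I -> T}) <-> forall i, (fun g => g i) @ F --> f i.
Proof.
by rewrite cvg_sup; split=> h i; apply/cvg_initialP; exact: h.
Qed.

Context {R : realType} {H : hilbertType R}.
Implicit Types (u v w : H) (x y z : bop H).
Local Notation "x %:C" := (real_complex R x) : ring_scope.

Lemma cvg_weakP (F : set_system (bop H)) (FF : Filter F) x :
  F --> (x : weak_bop H) <->
  forall u v, (fun y => inner (y u) v : R[i]^o) @ F --> inner (x u) v.
Proof.
rewrite cvg_initialP cvg_ptwsP; split => [h u v|h [u v]]; last exact: h.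
exact: (h (u, v)).
Qed.

Lemma cvg_strong_starP (F : set_system (bop H)) (FF : Filter F) x :
  F --> (x : strong_star_bop H) <->
  forall v, (fun y => y v) @ F --> x v /\ (fun y => adjoint y v) @ F --> adjoint x v.
Proof.
rewrite cvg_initialP; split=> [h v|h].
  split.
    have : (fun p : {ptws H -> H} * {ptws H -> H} => p.1) @
        (values_and_adjoint_values @ F) --> (x : {ptws H -> H}).
      apply: cvg_trans (cvg_fst (F := nbhs (x : {ptws H -> H}))
      (G := nbhs (adjoint x : {ptws H -> H}))).
      exact: cvg_app h.
    by move=> /cvg_ptwsP /(_ v).
  have : (fun p : {ptws H -> H} * {ptws H -> H} => p.2) @
        (values_and_adjoint_values @ F) --> (adjoint x : {ptws H -> H}).
    apply: cvg_trans (cvg_snd (F := nbhs (x : {ptws H -> H}))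
      (G := nbhs (adjoint x : {ptws H -> H}))).
    exact: cvg_app h.
  by move=> /cvg_ptwsP /(_ v).
have h1 : (fun y : bop H => (y : H -> H)) @ F --> (x : {ptws H -> H}).
  by apply/cvg_ptwsP => v; case: (h v).
have h2 : (fun y : bop H => (adjoint y : H -> H)) @ F --> (adjoint x : {ptws H -> H}).
  by apply/cvg_ptwsP => v; case: (h v).
exact: (@cvg_pair _ {ptws H -> H} {ptws H -> H} F _ _ _ _ _ _ _ h1 h2).
Qed.

Lemma cvg_inner T (F : set_system T) (FF : Filter F) (f : T -> H) l v :
  f @ F --> l -> (fun t => inner (f t) v : R[i]^o) @ F --> inner l v.
Proof.
move=> /cvg_rnormP fl; apply/cvgrPdist_lt => -[a b].
rewrite ltcE /= => /andP[/eqP -> a0].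
have v0 : 0 < rnorm v + 1 by rewrite ltr_wpDl ?rnorm_ge0.
have : 0 < a / (rnorm v + 1) by rewrite divr_gt0.
move=> /fl; apply: filterS => t; rewrite ltr_pdivlMr // => h.
rewrite -linearBl; apply: le_lt_trans (normc_inner _ _) _.
rewrite ltcR; apply: le_lt_trans h.
by rewrite ler_wpM2l ?rnorm_ge0 // lerDl.
Qed.

(** Invariance under pointwise norm limits of sequences: what the fixed
    point of an iteration inherits from the iterates, and a property shared by
    von Neumann algebras, commutants and the set of self-adjoint operators. *)
Definition seq_strongly_closed (P : set (bop H)) :=
  forall (z : nat -> bop H) x, (forall n, P (z n)) ->
    (forall v, z n v @[n --> \oo] --> x v) -> P x.

Lemma vna_seq_strongly_closed (N : set (bop H)) :
  von_neumann_algebra N -> seq_strongly_closed N.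
Proof.
move=> hN z x Nz zx.
have zw : z @ \oo --> (x : weak_bop H).
  by apply/cvg_weakP => u v; apply: cvg_inner; exact: zx.
apply: (@closed_cvg nat (weak_bop H) \oo _ z N (vna_weakly_closed hN) _ x zw).
exact: nearW.
Qed.

End topology.

(** * Fixed points of contractions of B(H) *)

Section fixpoint.
Context {R : realType} {H : hilbertType R}.
Implicit Types (u v w : H) (x y z : bop H).
Local Notation "x %:C" := (real_complex R x) : ring_scope.

Lemma geometric_lt (k c e : R) : 0 <= k < 1 -> 0 <= c -> 0 < e ->
  exists N, forall n, (N <= n)%N -> c * k ^+ n < e.
Proof.
move=> /andP[k0 k1] c0 e0.
have : (fun n => k ^+ n : R^o) @ \oo --> (0 : R^o).
  by apply: cvg_expr; rewrite ger0_norm.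
have ec : 0 < e / (c + 1) by rewrite divr_gt0 // ltr_wpDl.
move=> /cvgrPdist_lt /(_ _ ec) [N _ hN]; exists N => n /hN /=.
rewrite sub0r normrN ger0_norm ?exprn_ge0 // ltr_pdivlMr ?ltr_wpDl // => h.
apply: le_lt_trans h; rewrite mulrC ler_wpM2l ?exprn_ge0 // lerDl //.
Qed.

Lemma geometric_le0 (k c a : R) : 0 <= k < 1 -> 0 <= c ->
  (forall n, a <= c * k ^+ n) -> a <= 0.
Proof.
move=> k01 c0 ha; rewrite leNgt; apply/negP => a0.
have [N /(_ N (leqnn _))] := geometric_lt k01 c0 a0.
by rewrite ltNge ha.
Qed.

Lemma cvg_rnorm_le T (F : set_system T) (FF : ProperFilter F) (f : T -> H) l a :
  f @ F --> l -> (\forall t \near F, rnorm (f t) <= a) -> rnorm l <= a.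
Proof.
move=> /cvg_rnormP fl fa; apply/ler_addgt0Pr => e e0.
have [t [h1 h2]] := filter_ex (filterI (fl e e0) fa).
have := rnorm_triangle (l - f t) (f t); rewrite subrK; lra.
Qed.

Lemma bop_pointwise_limit (z : nat -> bop H) (f : H -> H) r :
  (forall n, bounded_by r (z n)) -> (forall v, z n v @[n --> \oo] --> f v) ->
  exists2 b : bop H, bounded_by r b & b = f :> (H -> H).
Proof.
move=> zr zf.
have fl : linear f.
  move=> a u v.
  have h1 := zf (a *: u + v).
  have h2 : (fun n => a *: z n u + z n v) @ \oo --> a *: f u + f v.
    by apply: cvgD; [apply: cvgZl_tmp; exact: zf|exact: zf].
  apply: (cvg_unique _ h1) => //.
  rewrite (_ : (fun n => z n (a *: u + v)) = (fun n => a *: z n u + z n v)) //.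
  by apply/funext => n; rewrite bop_linear.
have fr v : rnorm (f v) <= r * rnorm v.
  apply: (@cvg_rnorm_le nat \oo _ _ _ _ (zf v)); apply: nearW => n; exact: zr.
by exists (Bop (bounded_linear_of_bound fl fr)).
Qed.

(** The iterates of Phi from 0 are Cauchy at each vector, at a rate uniform on
    bounded sets, so that the pointwise limit is a bounded operator and is
    fixed by Phi. The set P records the properties of the iterates that the
    limit is to inherit. *)
Lemma contraction_fixpoint (P : set (bop H)) (Phi : bop H -> bop H) (r k : R) :
  0 <= k < 1 -> 0 <= r -> seq_strongly_closed P -> P 0 ->
  (forall z, P z -> P (Phi z)) ->
  (forall z, bounded_by r z -> bounded_by r (Phi z)) ->
  (forall z y d, 0 <= d -> bounded_by r z -> bounded_by r y ->
     bounded_by d (z - y) -> bounded_by (k * d) (Phi z - Phi y)) ->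
  exists b, [/\ P b, bounded_by r b & Phi b = b].
Proof.
move=> k01 r0 Pcl P0 PPhi rPhi kPhi; have /andP[k0 k1] := k01.
pose z n := iter n Phi 0.
have Pz n : P (z n) by elim: n => //= n; exact: PPhi.
have zr n : bounded_by r (z n).
  elim: n => [v|n]; last exact: rPhi.
    by have -> : z 0%N v = 0 by []; rewrite rnorm0 mulr_ge0 ?rnorm_ge0.
have zk n m : bounded_by (r * k ^+ n) (z (n + m)%N - z n).
  elim: n => [|n ih]; first by rewrite subr0 mulr1.
  rewrite addSn exprS mulrCA; apply: kPhi => //.
  by rewrite mulr_ge0 ?exprn_ge0.
have /choice [f zf] v : exists l : H, z n v @[n --> \oo] --> l.
  apply: rnorm_complete => e e0.
  have e2 : 0 < e / 2 by rewrite divr_gt0.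
  have rv : 0 <= r * rnorm v by rewrite mulr_ge0 ?rnorm_ge0.
  have [N hN] := geometric_lt k01 rv e2; exists N => m n Nm Nn.
  have := zk N (m - N)%N v; have := zk N (n - N)%N v; have := hN N (leqnn _).
  rewrite !subnKC // !bop_subE mulrAC => h1 h2 h3.
  have := rnorm_triangle (z m v - z N v) (z N v - z n v).
  rewrite addrA subrK -(rnormN (z N v - z n v)) opprB; lra.
have [b br bf] := bop_pointwise_limit zr zf.
have zb v : z n v @[n --> \oo] --> b v by rewrite bf; exact: zf.
exists b; split => //; first exact: (Pcl z).
have bz n : bounded_by (r * k ^+ n) (b - z n).
  move=> v; rewrite bop_subE.
  apply: (@cvg_rnorm_le _ \oo _ (fun m => z m v - z n v)).
    by apply: cvgB => //; exact: cvg_cst.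
  exists n => // m /= nm; have := zk n (m - n)%N v.
  by rewrite subnKC.
apply: bopP => v; apply/eqP; rewrite -subr_eq0; apply/eqP/rnorm0_eq0/eqP.
rewrite eq_le rnorm_ge0 andbT.
apply: (@geometric_le0 k (2 * r * rnorm v)) => //.
  by rewrite !mulr_ge0 ?rnorm_ge0.
move=> n.
have h1 : bounded_by (k * (r * k ^+ n)) (Phi b - z n.+1).
  by apply: kPhi => //; rewrite mulr_ge0 ?exprn_ge0.
have := h1 v; have := bz n.+1 v; rewrite !bop_subE => h2 h3.
have := rnorm_triangle (Phi b v - z n.+1 v) (z n.+1 v - b v).
rewrite addrA subrK -(rnormN (z n.+1 v - b v)) opprB.
have kn : k * (r * k ^+ n) * rnorm v <= r * rnorm v * k ^+ n.
  rewrite (_ : _ * rnorm v = k * (r * rnorm v * k ^+ n)); last by ring.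
  by rewrite ler_piMl ?(ltW k1) // !mulr_ge0 ?exprn_ge0 ?rnorm_ge0.
move: h2; rewrite exprS mulrCA => h2.
rewrite (_ : 2 * r * _ * _ = 2 * (r * rnorm v * k ^+ n)); last by ring.
lra.
Qed.

End fixpoint.

(** * Inverses, square roots and means of unitaries *)

Section closed.
Context {R : realType} {H : hilbertType R}.
Implicit Types (u v w : H) (x y z : bop H).
Local Notation "x %:C" := (real_complex R x) : ring_scope.

Lemma cvg_rinner T (F : set_system T) {FF : Filter F} (f : T -> H) l v :
  f @ F --> l -> (fun t => rinner (f t) v : R^o) @ F --> (rinner l v : R^o).
Proof.
move=> /cvg_rnormP fl; apply/cvgrPdist_lt => a a0.
have v0 : 0 < rnorm v + 1 by rewrite ltr_wpDl ?rnorm_ge0.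
have : 0 < a / (rnorm v + 1) by rewrite divr_gt0.
move=> /fl; apply: filterS => t; rewrite ltr_pdivlMr // => h.
rewrite -rinnerNl -rinnerDl; apply: le_lt_trans (le_rinner _ _) _.
by apply: le_lt_trans h; rewrite ler_wpM2l ?rnorm_ge0 // lerDl.
Qed.

Lemma seq_strongly_closed_self_adjoint :
  seq_strongly_closed [set x : bop H | adjoint x = x].
Proof.
move=> z x za zx; apply: adjoint_unique => u v.
have h1 : (fun n => rinner (z n u) v : R^o) @ \oo --> (rinner (x u) v : R^o).
  by apply: cvg_rinner; exact: zx.
have h2 : (fun n => rinner (z n v) u : R^o) @ \oo --> (rinner (x v) u : R^o).
  by apply: cvg_rinner; exact: zx.
have E : (fun n => rinner (z n u) v : R^o) = (fun n => rinner (z n v) u : R^o).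
  by apply/funext => n; rewrite [RHS]rinnerC -adjointPl za.
rewrite E in h1; rewrite [RHS]rinnerC; exact: (cvg_unique (@norm_hausdorff _ R^o) h1 h2).
Qed.

Lemma seq_strongly_closed_commute d :
  seq_strongly_closed [set x : bop H | d * x = x * d].
Proof.
move=> z x za zx; apply: bopP => v; rewrite !bop_mulE.
apply: (cvg_unique _ _ (zx (d v))) => //.
rewrite (_ : (fun n => z n (d v)) = (fun n => d (z n v))).
  by apply: continuous_cvg; [exact: bop_continuous|exact: zx].
by apply/funext => n; rewrite -!bop_mulE za.
Qed.

Lemma seq_strongly_closedI (P Q : set (bop H)) :
  seq_strongly_closed P -> seq_strongly_closed Q -> seq_strongly_closed (P `&` Q).
Proof.
move=> hP hQ z x zPQ zx; split; [apply: hP zx => n|apply: hQ zx => n];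
by case: (zPQ n).
Qed.

End closed.

Section algebra.
Context {R : realType} {H : hilbertType R}.
Variable N : set (bop H).
Hypothesis hN : von_neumann_algebra N.
Implicit Types (u v w : H) (x y z : bop H).
Local Notation "x %:C" := (real_complex R x) : ring_scope.

Lemma vna_zero : N 0.
Proof. by rewrite -(scale0r (1 : bop H)); apply: vna_scale => //; exact: vna_one. Qed.
Lemma vna_opp x : N x -> N (- x).
Proof. by move=> Nx; rewrite -scaleN1r; exact: vna_scale. Qed.
Lemma vna_sub x y : N x -> N y -> N (x - y).
Proof. by move=> Nx Ny; apply: vna_add => //; exact: vna_opp. Qed.

Lemma half_double x : (2^-1)%:C *: (x + x) = x.
Proof.
by rewrite scalerDr -scalerDl -rmorphD /= (_ : _ + _ = 1) ?scale1r //; field.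
Qed.

(** The right inverse is the fixed point of g |-> 1 + z g; it is also a left
    inverse because it commutes with z, as the iterates do. *)
Lemma one_sub_inverse z q : 0 <= q < 1 -> N z -> bounded_by q z ->
  exists g, [/\ N g, bounded_by (1 - q)^-1 g, (1 - z) * g = 1 & g * (1 - z) = 1].
Proof.
move=> q01 Nz zq; have /andP[q0 q1] := q01.
have := @contraction_fixpoint R H (N `&` [set g | z * g = g * z])
  (fun g => 1 + z * g) (1 - q)^-1 q q01.
case.
- by rewrite invr_ge0 subr_ge0 ltW.
- by apply: seq_strongly_closedI;
    [exact: vna_seq_strongly_closed|exact: seq_strongly_closed_commute].
- by split; [exact: vna_zero|rewrite /= mulr0 mul0r].
- move=> g [Ng zg]; split; last by rewrite /= mulrDl mulrDr mul1r mulr1 -mulrA zg.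
  by apply: vna_add => //; [exact: vna_one|exact: vna_mul].
- move=> g gr; have -> : (1 - q)^-1 = 1 + q * (1 - q)^-1.
    by have : 1 - q != 0 by [rewrite subr_eq0 gt_eqF|]; move=> ?; field.
  by apply: bounded_byD; [exact: bounded_by1|exact: bounded_byM].
- move=> a b d d0 _ _ abd; rewrite opprD addrACA subrr add0r -mulrBr.
  exact: bounded_byM.
move=> g [[Ng zg] gb gE]; exists g; split => //.
- by rewrite mulrBl mul1r -{1}gE addrK.
- by rewrite mulrBr mulr1 -zg -{1}gE addrK.
Qed.

(** The square root is s = 1 - b, where b is the fixed point of
    b |-> (c + b^2) / 2. The last clause, s being in the bicommutant of c, is
    what makes square roots of commuting elements commute. *)
Lemma square_root c q : 0 <= q < 1 -> N c -> adjoint c = c -> bounded_by q c ->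
  exists s, [/\ N s, adjoint s = s, s * s = 1 - c &
    forall d, d * c = c * d -> d * s = s * d].
Proof.
move=> /andP[q0 q1] Nc ca cq.
(* the iteration maps the ball of radius b0 into itself as q + b0^2 <= 2 b0,
   and is b0-Lipschitz there *)
pose b0 := (1 + q) / 2.
have b01 : 0 <= b0 < 1 by rewrite /b0; apply/andP; split; lra.
have /andP[b00 b11] := b01.
pose P := [set b | [/\ N b, adjoint b = b & forall d, d * c = c * d -> d * b = b * d]].
have := @contraction_fixpoint R H P (fun b => (2^-1)%:C *: (c + b * b)) b0 b0 b01 b00.
have half2 : `|2^-1 : R| = 2^-1 by rewrite ger0_norm // invr_ge0.
case.
- move=> z x zP zx; split.
  + by apply: (vna_seq_strongly_closed hN _ zx) => n; case: (zP n).
  + by apply: (seq_strongly_closed_self_adjoint _ zx) => n; case: (zP n).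
  + move=> d dc; apply: (@seq_strongly_closed_commute _ _ d _ _ _ zx) => n.
    by case: (zP n) => _ _; apply.
- split; first exact: vna_zero.
  + by rewrite -(scale0r (0 : bop H)) adjointZ rmorph0 !scale0r.
  + by move=> d _; rewrite mulr0 mul0r.
- move=> b [Nb ba bc]; split.
  + by apply: vna_scale => //; apply: vna_add => //; exact: vna_mul.
  + by rewrite adjointZr adjointD adjointM ca ba.
  + move=> d dc; rewrite -bop_scalerAr -bop_scalerAl mulrDr mulrDl dc.
    by rewrite mulrA (bc d dc) -mulrA (bc d dc) mulrA.
- move=> b bb; apply: bounded_byW (bounded_byZ _
    (bounded_byD cq (bounded_byM b00 bb bb))).
  by rewrite half2 /b0; nra.
- move=> a b d d0 ab bb abd; rewrite -scalerBr.
  have -> : c + a * a - (c + b * b) = a * (a - b) + (a - b) * b.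
    by rewrite mulrBr mulrBl addrA subrK opprD addrACA subrr add0r.
  apply: bounded_byW (bounded_byZ _
    (bounded_byD (bounded_byM b00 ab abd) (bounded_byM d0 abd bb))).
  by rewrite half2; lra.
move=> b [[Nb ba bc] bb bE]; exists (1 - b); split.
- by apply: vna_sub => //; exact: vna_one.
- by rewrite adjointD adjointN adjoint1 ba.
- have b2 : b + b = c + b * b.
    by rewrite -{1 2}bE -scalerDr half_double.
  rewrite mulrBr mulr1 mulrBl mul1r opprB addrA -[1 - b + b * b - b]addrA.
  rewrite [LHS](_ : _ = 1 - (b + b) + b * b).
    by rewrite b2 opprD addrA subrK.
  by rewrite opprD !addrA [in LHS]addrAC.
- by move=> d dc; rewrite mulrBr mulrBl mulr1 mul1r bc.
Qed.

Definition unitary x := adjoint x * x = 1 /\ x * adjoint x = 1.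

Lemma unitaryM x y : unitary x -> unitary y -> unitary (x * y).
Proof.
move=> [x1 x2] [y1 y2]; split; rewrite adjointM.
  by rewrite mulrA -(mulrA (adjoint y)) x1 mulr1.
by rewrite mulrA -(mulrA x) y2 mulr1.
Qed.

Lemma unitary_adjoint x : unitary x -> unitary (adjoint x).
Proof. by move=> [x1 x2]; split; rewrite adjointK. Qed.

(** Gardner's step: y = (1 + x) / 2 is invertible with norm less than 1, hence
    of the form v s with v unitary and s^2 = y^* y, and s is the
    midpoint of the two unitaries s + i t and s - i t for t^2 = 1 - s^2. *)
Lemma half_one_add_unitaries x q : 0 <= q < 1 -> N x -> bounded_by q x ->
  exists a b, [/\ N a, N b, unitary a, unitary b &
    (2^-1)%:C *: (1 + x) = (2^-1)%:C *: (a + b)].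
Proof.
move=> q01 Nx xq; have /andP[q0 q1] := q01.
have N1 := vna_one hN.
set y := _ *: (1 + x).
have Ny : N y by apply: vna_scale => //; exact: vna_add.
have half2 : `|2^-1 : R| = 2^-1 by rewrite ger0_norm // invr_ge0.
pose p := 2^-1 * (1 + q).
have p01 : 0 <= p < 1 by apply/andP; split; rewrite /p; lra.
have /andP[p0 p1] := p01.
have yp : bounded_by p y.
  by rewrite /p -half2; apply: bounded_byZ; apply: bounded_byD => //; exact: bounded_by1.
have [g0 [Ng0 g0b g0r g0l]] := one_sub_inverse q01 (vna_opp Nx) (bounded_byN xq).
rewrite opprK in g0r g0l.
pose g := 2%:C *: g0.
have half22 : (2^-1)%:C * 2%:C = 1 :> R[i] by rewrite -rmorphM mulVf.
have yg : y * g = 1.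
  by rewrite /y /g -bop_scalerAl -bop_scalerAr g0r scalerA half22 scale1r.
have gy : g * y = 1.
  by rewrite /y /g -bop_scalerAl -bop_scalerAr g0l scalerA mulrC half22 scale1r.
have Ng : N g by apply: vna_scale.
set A := adjoint y; set G := adjoint g.
have NA : N A by apply: vna_adjoint.
have NG : N G by apply: vna_adjoint.
have AG : A * G = 1 by rewrite -adjointM gy adjoint1.
have GA : G * A = 1 by rewrite -adjointM yg adjoint1.
have Ap : bounded_by p A by apply: bounded_by_adjoint.
pose e := (1 - q) / 2.
have e0 : 0 < e by rewrite /e; lra.
have e1 : e <= 1 by rewrite /e; lra.
have ylow v : e * rnorm v <= rnorm (y v).
  have := bounded_byZ 2 g0b (y v); rewrite -/g -bop_mulE gy ger0_norm //.
  rewrite -[rnorm ((1 : bop H) v)]/(rnorm v) => h.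
  rewrite mulrC -ler_pdivlMr // mulrC; apply: le_trans h _.
  by rewrite /e invf_div.
clearbody e.
(* s and t below are square roots of 1 - c1 = y^* y and of 1 - c2 = 1 - y^* y *)
pose c1 := 1 - A * y; pose c2 := A * y.
have Nc2 : N c2 by apply: vna_mul.
have Nc1 : N c1 by apply: vna_sub.
have c2a : adjoint c2 = c2 by rewrite /c2 adjointM /A adjointK.
have c1a : adjoint c1 = c1 by rewrite /c1 adjointD adjointN adjoint1 c2a.
have c2q : bounded_by (p * p) c2 by apply: bounded_byM.
(* |v - y^* y v|^2 <= |v|^2 - |y v|^2 <= (1 - e^2) |v|^2, and the square of
   1 - e^2 / 2 exceeds 1 - e^2 *)
have c1q : bounded_by (1 - e ^+ 2 / 2) c1.
  move=> v; rewrite -(ler_pXn2r (n:=2)) ?nnegrE ?mulr_ge0 ?rnorm_ge0 //; last by nra.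
  rewrite /c1 bop_subE -[(1 : bop H) v]/v bop_mulE sqr_rnormB.
  rewrite rinnerC adjointPl -sqr_rnorm.
  have h1 : rnorm (A (y v)) ^+ 2 <= rnorm (y v) ^+ 2.
    rewrite ler_pXn2r ?nnegrE ?rnorm_ge0 //; apply: le_trans (Ap _) _.
    by rewrite ler_piMl ?rnorm_ge0 // ltW.
  have h2 : (e * rnorm v) ^+ 2 <= rnorm (y v) ^+ 2.
    by rewrite ler_pXn2r ?nnegrE ?rnorm_ge0 ?(mulr_ge0 (ltW e0) (rnorm_ge0 v)).
  have h3 : (1 - e ^+ 2) * rnorm v ^+ 2 <= ((1 - e ^+ 2 / 2) * rnorm v) ^+ 2.
    rewrite exprMn ler_wpM2r ?sqr_ge0 //; have := sqr_ge0 (e ^+ 2); nra.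
  by rewrite exprMn in h2; lra.
have [s [Ns sa s2 sC]] : exists s, [/\ N s, adjoint s = s, s * s = 1 - c1 &
    forall d, d * c1 = c1 * d -> d * s = s * d].
  apply: square_root c1a c1q => //; apply/andP; split; nra.
have [t [Nt ta t2 tC]] : exists s, [/\ N s, adjoint s = s, s * s = 1 - c2 &
    forall d, d * c2 = c2 * d -> d * s = s * d].
  apply: square_root c2a c2q => //; apply/andP; split; nra.
rewrite /c1 opprB addrC subrK in s2.
have st : s * t = t * s.
  by apply: tC; symmetry; apply: sC; rewrite /c1 -/c2 mulrBr mulrBl mulr1 mul1r.
have gGs : g * G * s = s * (g * G).
  apply: sC; rewrite /c1 mulrBr mulrBl mulr1 mul1r; congr (_ - _).
  rewrite (mulrA (g * G)) -(mulrA g) GA mulr1 gy.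
  by rewrite mulrA -(mulrA A) yg mulr1 AG.
(* y = v s with v = y s^-1, rewritten as (y^-1)^* s to avoid the inverse of s *)
pose v := G * s.
have Nv : N v by apply: vna_mul.
have va : adjoint v = s * g by rewrite /v adjointM sa /G adjointK.
have vu : unitary v.
  split; rewrite va /v.
    by rewrite mulrA -(mulrA s) -mulrA gGs mulrA s2 mulrA -(mulrA A) yg mulr1.
  by rewrite mulrA -(mulrA G) s2 mulrA GA mul1r yg.
pose h := s + 'i%C *: t.
have ha : adjoint h = s - 'i%C *: t.
  by rewrite /h adjointD sa adjointZ ta conj_i scaleNr.
have hu : unitary h.
  have tt : ('i%C *: t) * ('i%C *: t) = - (t * t).
    rewrite -bop_scalerAl -bop_scalerAr scalerA -expr2 sqr_i scaleN1r //.
  have sti : s * ('i%C *: t) = ('i%C *: t) * s.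
    by rewrite -bop_scalerAr st bop_scalerAl.
  split; rewrite ha /h.
    rewrite mulrDr !mulrBl sti tt opprK addrA subrK.
    by rewrite s2 t2 addrC subrK.
  rewrite mulrBr !mulrDl sti tt opprD opprK addrA addrK.
  by rewrite s2 t2 addrC subrK.
exists (v * h), (v * adjoint h); split.
- by apply: vna_mul => //; apply: vna_add => //; exact: vna_scale.
- rewrite ha; apply: vna_mul => //; apply: vna_sub => //; exact: vna_scale.
- exact: unitaryM.
- by apply: unitaryM => //; exact: unitary_adjoint.
rewrite -mulrDr ha /h addrACA subrr addr0 mulrDr half_double.
by rewrite /v -mulrA s2 mulrA GA mul1r.
Qed.

(** Convex combinations with dyadic coefficients; midpoints are all that the
    approximation argument needs. *)
Inductive mean_of_unitaries : bop H -> Prop :=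
| mean_unitary x of N x & unitary x : mean_of_unitaries x
| mean_midpoint x y of mean_of_unitaries x & mean_of_unitaries y :
    mean_of_unitaries ((2^-1)%:C *: (x + y)).

Lemma unitary_bounded x : unitary x -> bounded_by 1 x.
Proof.
move=> [x1 _] v; rewrite mul1r -(ler_pXn2r (n:=2)) ?nnegrE ?rnorm_ge0 //.
by rewrite !sqr_rnorm adjointP -bop_mulE x1.
Qed.

(** For a unitary u, (u + x) / 2 = u (1 + u^* x) / 2 is handled by
    [half_one_add_unitaries]; midpoints then propagate by linearity. *)
Lemma mean_of_unitaries_halfway x z q : 0 <= q < 1 -> N x -> bounded_by q x ->
  mean_of_unitaries z -> mean_of_unitaries ((2^-1)%:C *: (z + x)).
Proof.
move=> q01 Nx xq; elim=> {z} [u Nu uu|a b _ iha _ ihb].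
  have [ux1 ux2] := uu.
  have [] := @half_one_add_unitaries (adjoint u * x) q q01.
  - by apply: vna_mul => //; exact: vna_adjoint.
  - rewrite -[q]mul1r; apply: bounded_byM => //.
    by apply: unitary_bounded; exact: unitary_adjoint.
  move=> a [b [Na Nb ua ub ab]].
  have -> : (2^-1)%:C *: (u + x) = (2^-1)%:C *: (u * a + u * b).
    rewrite -mulrDr bop_scalerAr -ab -bop_scalerAr mulrDr mulr1 mulrA ux2 mul1r //.
  by apply: mean_midpoint; apply: mean_unitary; try exact: unitaryM; exact: vna_mul.
have -> : (2^-1)%:C *: ((2^-1)%:C *: (a + b) + x)
    = (2^-1)%:C *: ((2^-1)%:C *: (a + x) + (2^-1)%:C *: (b + x)).
  congr (_ *: _); rewrite -scalerDr addrACA [RHS]scalerDr; congr (_ + _).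
  by rewrite half_double.
exact: mean_midpoint.
Qed.

(** The Russo-Dye theorem, as an induction principle for the contractions of N.
    If x has norm less than 1, the means of unitaries z 0 = 1,
    z n.+1 = (z n + x) / 2 differ from x by 2^-n (1 - x); a general contraction
    x is the limit of (1 - 2^-n) x. *)
Lemma russo_dye (P : bop H -> Prop) :
  (forall x, N x -> unitary x -> P x) ->
  (forall x y, P x -> P y -> P ((2^-1)%:C *: (x + y))) ->
  (forall (z : nat -> bop H) x, (forall n, P (z n)) ->
    z @ \oo --> (x : strong_star_bop H) -> P x) ->
  forall x, N x -> bounded_by 1 x -> P x.
Proof.
move=> Pu Pm Pl x Nx x1.
have Pmean z : mean_of_unitaries z -> P z by elim=> *; [exact: Pu|exact: Pm].
pose r (n : nat) : R := 2^-1 ^+ n.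
have r_cvg (f : nat -> bop H) b : (forall n, f n = b + (r n)%:C *: (f 0%N - b)) ->
    f @ \oo --> (b : strong_star_bop H).
  move=> fE; apply/cvg_strong_starP => v.
  have key (c d : bop H) : (fun n => (c + (r n)%:C *: d) v) @ \oo --> c v.
    apply/cvg_rnormP => e e0.
    have h01 : 0 <= (2^-1 : R) < 1 by apply/andP; split; lra.
    have [n0 hn] := geometric_lt h01 (rnorm_ge0 (d v)) e0.
    exists n0 => // n /hn; rewrite bopD bopZ opprD addrA subrr sub0r rnormN rnormZ.
    by rewrite ger0_norm ?exprn_ge0 ?invr_ge0 // mulrC.
  split.
    rewrite -[X in X --> _]/((fun n => f n v) @ \oo).
    rewrite (_ : (fun n => f n v) = fun n => (b + (r n)%:C *: (f 0%N - b)) v) //.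
    by apply/funext => n; rewrite {1}fE.
  rewrite -[X in X --> _]/((fun n => adjoint (f n) v) @ \oo).
  rewrite (_ : (fun n => adjoint (f n) v) =
      fun n => (adjoint b + (r n)%:C *: adjoint (f 0%N - b)) v) //.
  by apply/funext => n; rewrite {1}fE [in LHS]adjointD adjointZr.
have rS n : (2^-1)%:C * (r n)%:C = (r n.+1)%:C by rewrite -rmorphM -exprS.
have strict y q : 0 <= q < 1 -> N y -> bounded_by q y -> P y.
  move=> q01 Ny yq.
  pose z n := iter n (fun z => (2^-1)%:C *: (z + y)) 1.
  have zmean n : mean_of_unitaries (z n).
    elim: n => [|n ih]; last exact: (mean_of_unitaries_halfway q01 Ny yq ih).
    by apply: mean_unitary; [exact: vna_one|split; rewrite adjoint1 mulr1].
  apply: (Pl z); first by move=> n; exact: Pmean.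
  apply: r_cvg; elim=> [|n ih]; first by rewrite scale1r addrC subrK.
  rewrite [LHS]/= -/(z n) {1}ih -rS -scalerA addrAC scalerDr; congr (_ + _).
  by rewrite half_double.
apply: (Pl (fun n => (1 - r n)%:C *: x)).
  move=> n; apply: (strict _ (1 - r n)).
  - have h1 : 0 < r n by rewrite exprn_gt0.
    have h2 : r n <= 1 by rewrite exprn_ile1 //; lra.
    by apply/andP; split; lra.
  - exact: vna_scale.
  - have h2 : 0 <= 1 - r n by rewrite subr_ge0 exprn_ile1 //; lra.
    by rewrite -{1}(ger0_norm h2) -[X in bounded_by X]mulr1; exact: bounded_byZ.
apply: r_cvg => n.
by rewrite /r expr0 subrr scale0r sub0r scalerN rmorphB scalerBl scale1r.
Qed.

End algebra.

(** * Comparison of the lower topologies *)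

Section lower.
Context {S : choiceType} {X : topologicalType} (F : S -> set X).

Lemma open_lower_subbase (U : set X) : open U ->
  @open (lower_topology F) [set s | F s `&` U !=set0].
Proof.
move=> oU; exists [set [set s | F s `&` U !=set0]]; last by rewrite bigcup_set1.
move=> _ ->; exists [fset U]%fset.
  by move=> V; rewrite !inE => /eqP ->; exact: mem_set.
by rewrite set_fset1 bigcap_set1.
Qed.

Lemma lower_topology_coarser (T : topologicalType) (f : T -> S) :
  (forall (U : set X) t, open U -> F (f t) `&` U !=set0 ->
    \forall t' \near t, F (f t') `&` U !=set0) ->
  forall W : set S, @open (lower_topology F) W -> open (f @^-1` W).
Proof.
move=> subF _ [B sB <-]; rewrite openE => t [C BC Ct].
have /sB [D sD IDC] := BC.
rewrite /interior; apply: (@filterS _ _ _ (f @^-1` C)).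
  by move=> t' Ct'; exists C.
rewrite -IDC preimage_bigcap; apply: filter_bigI => U DU.
apply: subF; first exact: (set_mem (sD _ DU)).
by move: Ct; rewrite -IDC; apply.
Qed.

End lower.

Section main.
Context {R : realType} {H : hilbertType R}.
Implicit Types (u v w : H) (x y z : bop H).
Local Notation "x %:C" := (real_complex R x) : ring_scope.

Lemma strong_star_cvg_weak x :
  nbhs (x : strong_star_bop H) --> (x : weak_bop H).
Proof.
have /cvg_strong_starP h := @cvg_id _ (nbhs (x : strong_star_bop H)).
by apply/cvg_weakP => u v; apply: cvg_inner; case: (h u).
Qed.

Lemma weak_open_strong_star_open (V : set (bop H)) :
  @open (weak_bop H) V -> @open (strong_star_bop H) V.
Proof.
move=> oV; rewrite openE => x Vx.
by apply: (@strong_star_cvg_weak x); exact: open_nbhs_nbhs.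
Qed.

Lemma cvg_weak_rinner (F : set_system (bop H)) (FF : Filter F) x u v :
  F --> (x : weak_bop H) ->
  (fun y => rinner (y u) v : R^o) @ F --> (rinner (x u) v : R^o).
Proof.
move=> /cvg_weakP /(_ u v) /cvgrPdist_lt h; apply/cvgrPdist_lt => e e0.
have := h e%:C; rewrite ltcR => /(_ e0); apply: filterS => y.
move=> hy; rewrite -ltcR; apply: le_lt_trans hy; rewrite normc_def lecR /= /rinner.
case: (inner (x u) v) (inner (y u) v) => [a b] [c d] /=.
by rewrite -sqrtr_sqr ler_wsqrtr // lerDl sqr_ge0.
Qed.

(** In a Hilbert space, weak convergence without gain of norm is norm
    convergence; testing against the limit itself is enough. *)
Lemma cvg_of_rinner_cvg T (F : set_system T) (FF : Filter F) (f : T -> H) a :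
  (\forall t \near F, rnorm (f t) <= rnorm a) ->
  (fun t => rinner (f t) a : R^o) @ F --> (rinner a a : R^o) ->
  f @ F --> a.
Proof.
move=> fa /cvgrPdist_lt ha; apply/cvg_rnormP => e e0.
have e2 : 0 < e ^+ 2 / 2 by rewrite divr_gt0 ?exprn_gt0.
have := ha _ e2; apply: filterS2 fa => t ft.
move=> /(le_lt_trans (ler_norm _)) h.
rewrite -(ltr_pXn2r (n:=2)) ?nnegrE ?rnorm_ge0 ?(ltW e0) //.
rewrite sqr_rnormB (rinnerC a).
have : rnorm (f t) ^+ 2 <= rnorm a ^+ 2 by rewrite ler_pXn2r ?nnegrE ?rnorm_ge0.
rewrite -sqr_rnorm in h; lra.
Qed.

(** On the unit ball, weak convergence to a unitary is strong-star convergence,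
    since both the unitary and its adjoint are isometric. *)
Lemma unitary_weak_strong_star x : unitary x ->
  within [set y | op_norm y <= 1] (nbhs (x : weak_bop H)) --> (x : strong_star_bop H).
Proof.
move=> ux; set F := within _ _.
have FF : Filter F by exact: within_filter.
have iso y v : unitary y -> rnorm (y v) = rnorm v.
  move=> [y1 _]; apply/eqP; rewrite -(eqrXn2 (n:=2)) ?rnorm_ge0 //.
  by rewrite !sqr_rnorm adjointP -bop_mulE y1.
have FW : F --> (x : weak_bop H) by exact: cvg_within.
have Fb : \forall y \near F, bounded_by 1 y.
  by apply: filterS (withinT _ _) => y /op_norm_le1.
apply/cvg_strong_starP => v; split; apply: cvg_of_rinner_cvg.
- by apply: filterS Fb => y /(_ v); rewrite mul1r (iso _ _ ux).
- exact: cvg_weak_rinner.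
- apply: filterS Fb => y /(bounded_by_adjoint ler01) /(_ v).
  by rewrite mul1r (iso _ _ (unitary_adjoint ux)).
rewrite adjointPl (rinnerC v).
rewrite (_ : (fun y => _) = (fun y : bop H => rinner (y (adjoint x v)) v : R^o)).
  exact: cvg_weak_rinner.
by apply/funext => y; rewrite adjointPl rinnerC.
Qed.

Variable M : set (bop H).

Lemma weak_lower_nbhs (A : vn_subalgebras M) x (V : set (bop H)) :
  unit_ball (set_val A) x -> nbhs (x : weak_bop H) V ->
  \forall B \near (A : weak_lower M), exists2 y, unit_ball (set_val B) y & V y.
Proof.
move=> Ax; rewrite nbhsE => -[W [oW Wx] WV].
pose U : set (unit_ball M : set (weak_bop H)) := set_val @^-1` W.
have oU : open U by exists W.
have Mball (B : vn_subalgebras M) y : unit_ball (set_val B) y -> unit_ball M y.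
  by have [_ BM] := set_mem (valP B); case=> [/BM My ?].
have : nbhs (A : weak_lower M) [set B | weak_ball_of B `&` U !=set0].
  apply: open_nbhs_nbhs; split; first exact: open_lower_subbase.
  by exists (exist _ x (mem_set (Mball _ _ Ax))).
apply: filterS => B [y [By Uy]]; exists (set_val y) => //; exact: WV.
Qed.

Lemma mean_cvg_strong_star x y :
  (fun p : bop H * bop H => (2^-1)%:C *: (p.1 + p.2)) @
    filter_prod (nbhs (x : strong_star_bop H)) (nbhs (y : strong_star_bop H)) -->
  ((2^-1)%:C *: (x + y) : strong_star_bop H).
Proof.
set F := filter_prod _ _.
have FF : Filter F by exact: filter_prod_filter.
have /cvg_strong_starP h1 : fst @ F --> (x : strong_star_bop H) by exact: cvg_fst.
have /cvg_strong_starP h2 : snd @ F --> (y : strong_star_bop H) by exact: cvg_snd.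
apply/cvg_strong_starP => v; have [h11 h12] := h1 v; have [h21 h22] := h2 v; split.
  rewrite bopZ bopD; apply: cvgZl_tmp; apply: cvgD; [exact: h11|exact: h21].
rewrite adjointZr adjointD.
rewrite -[X in X --> _]/((fun p : bop H * bop H =>
  adjoint ((2^-1)%:C *: (p.1 + p.2)) v) @ F).
rewrite (_ : (fun p : bop H * bop H => _) =
  fun p => (2^-1)%:C *: (adjoint p.1 v + adjoint p.2 v)).
  apply: cvgZl_tmp; apply: cvgD; [exact: h12|exact: h22].
by apply/funext => p; rewrite adjointZr adjointD.
Qed.

(** The analogue of [weak_lower_nbhs] for strong-star neighbourhoods, which
    carries the theorem: by [russo_dye] it is enough to treat unitaries, where
    the weak statement applies, midpoints and limits. *)
Lemma strong_star_lower_nbhs (A : vn_subalgebras M) x (V : set (bop H)) :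
  unit_ball (set_val A) x -> nbhs (x : strong_star_bop H) V ->
  \forall B \near (A : weak_lower M), exists2 y, unit_ball (set_val B) y & V y.
Proof.
move=> [Ax /op_norm_le1 x1] xV.
have hvna (B : vn_subalgebras M) : von_neumann_algebra (set_val B).
  by have [] := set_mem (valP B).
move: x Ax x1 V xV.
pose G x := forall V, nbhs (x : strong_star_bop H) V ->
  \forall B \near (A : weak_lower M), exists2 y, unit_ball (set_val B) y & V y.
apply: (russo_dye (hvna A) (P := G)).
- move=> x Ax ux V xV.
  have x1 : op_norm x <= 1 by apply/op_norm_le1; exact: unitary_bounded.
  have := weak_lower_nbhs (conj Ax x1) (unitary_weak_strong_star ux xV).
  by apply: filterS => B [y [By y1] yV]; exists y => //; exact: yV.
- move=> x y Gx Gy V /mean_cvg_strong_star [[V1 V2] /= [xV1 yV2] V12].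
  have := Gx _ xV1; have := Gy _ yV2; apply: filterS2 => B.
  move=> [b [Bb b1] bV] [a [Ba a1] aV].
  exists ((2^-1)%:C *: (a + b)); last exact: (V12 (a, b)).
  split; first by apply: vna_scale => //; exact: vna_add.
  move/op_norm_le1 in a1; move/op_norm_le1 in b1; apply/op_norm_le1.
  apply: bounded_byW (bounded_byZ _ (bounded_byD a1 b1)).
  by rewrite ger0_norm ?invr_ge0 //; lra.
- move=> z x Gz zx V; rewrite nbhsE => -[W [oW Wx] WV].
  have [n _ /(_ n (leqnn n)) /= zW] := zx _ (open_nbhs_nbhs (conj oW Wx)).
  apply: filterS (Gz n W (open_nbhs_nbhs (conj oW zW))) => B [y By Wy].
  by exists y => //; exact: WV.
Qed.

End main.

Theorem proposition6p4 (R : realType) (H : hilbertType R) (M : set (bop H))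
    (hM : von_neumann_algebra M) (U : set (vn_subalgebras M)) :
  @open (weak_lower M) U <-> @open (strong_star_lower M) U.
Proof.
split.
  apply: (@lower_topology_coarser _ _ (@weak_ball_of R H M) (strong_star_lower M) id).
  move=> V A [W oW <-] AV; apply: open_nbhs_nbhs; split => //.
  apply: (@open_lower_subbase _ _ (@strong_star_ball_of R H M) (set_val @^-1` W)).
  by exists W => //; exact: weak_open_strong_star_open.
apply: (@lower_topology_coarser _ _ (@strong_star_ball_of R H M) (weak_lower M) id).
move=> V A [W oW <-] [x [Ax Wx]].
have := strong_star_lower_nbhs Ax (open_nbhs_nbhs (conj oW Wx)).
apply: filterS => B [y By Wy].
have My : unit_ball M y.
  by have [_ BM] := set_mem (valP B); case: By => [/BM My ?].
by exists (exist _ y (mem_set My)).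
Qed.
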